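(* Let $P(\lambda)=A_2\lambda^2+A_1\lambda+A_0$ be a quadratic quaternion matrix polynomial whose coefficients $A_0,A_1,A_2\in M_n(\mathbb{H})$ are pairwise commuting unitary matrices, and let $Q(\lambda)=I\lambda^2+B_1\lambda+B_0$ be a monic quadratic quaternion matrix polynomial with $B_0,B_1\in M_n(\mathbb{H})$ such that $B_0$ is unitary, $B_1$ is normal and $B_1^*B_0=-B_1$. Let $$C_P=\begin{bmatrix}0&I\\-A_2^{-1}A_0&-A_2^{-1}A_1\end{bmatrix},\qquad C_Q=\begin{bmatrix}0&I\\-B_0&-B_1\end{bmatrix}$$ be the corresponding block companion matrices in $M_{2n}(\mathbb{H})$, and let $\lambda_1,\dots,\lambda_{2n}$ and $\mu_1,\dots,\mu_{2n}$ be the standard eigenvalues of $C_P$ and $C_Q$ respectively. Let $X\in M_{2n}(\mathbb{H})$ be a nonsingular matrix such that $X^{-1}C_PX=\operatorname{diag}(\lambda_1,\dots,\lambda_{2n})$. Then there exists a permutation $\pi$ of $\{1,2,\ldots,2n\}$ such that $$\sum_{i=1}^{2n}|\lambda_i-\mu_{\pi(i)}|^2\leq \|X\|_2^2\,\|X^{-1}\|_2^2\,\|C_P-C_Q\|_F^2 .$$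
   Context: $\mathbb{H}$ is the set of real quaternions and $M_N(\mathbb{H})$ is the set of $N\times N$ matrices over $\mathbb{H}$. For $A=(a_{ij})\in M_N(\mathbb{H})$, $A^*=(\bar a_{ji})$ is the conjugate transpose; $A$ is normal if $AA^*=A^*A$ and unitary if $AA^*=I=A^*A$. The Frobenius norm is $\|A\|_F=(\operatorname{trace}A^*A)^{1/2}$, i.e. $\|A\|_F^2=\sum_{i,j}|a_{ij}|^2$; the spectral norm is $\|A\|_2=\sup\{\|Ax\|_2/\|x\|_2: x\in\mathbb{H}^N,\ x\ne0\}$, where $\|x\|_2$ is the Euclidean norm on $\mathbb{H}^N$. A quaternion $\lambda_0$ is a right eigenvalue of $A\in M_N(\mathbb{H})$ if $Ax=x\lambda_0$ for some nonzero $x\in\mathbb{H}^N$. Every $A\in M_N(\mathbb{H})$ has exactly $N$ (counted with multiplicity) right eigenvalues that are complex numbers with nonnegative imaginary part; these are called the standard eigenvalues of $A$. Multiplicities are as follows: write $A=A'+A'' j$ with $A',A''\in M_N(\mathbb{C})$ and let $\chi_A=\begin{bmatrix}A'&A''\\-\overline{A''}&\overline{A'}\end{bmatrix}\in M_{2N}(\mathbb{C})$; then $\lambda_1,\dots,\lambda_N$ (with nonnegative imaginary parts) are the standard eigenvalues of $A$ exactly when the eigenvalues of $\chi_A$, counted with algebraic multiplicity, are $\lambda_1,\dots,\lambda_N,\bar\lambda_1,\dots,\bar\lambda_N$. *)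

(* Defs.v *)
From HB Require Import structures.
From mathcomp Require Import all_boot all_order all_algebra all_fingroup.
From mathcomp Require Import ring.
From mathcomp Require Import complex.
From mathcomp Require Import boolp classical_sets reals.

Set Implicit Arguments.
Unset Strict Implicit.
Unset Printing Implicit Defensive.

Import Order.TTheory GRing.Theory Num.Theory.
Local Open Scope ring_scope.

(* [Quat a b c d] is the quaternion a + b i + c j + d k. *)
Record quaternion (R : Type) := Quat { qre : R; qim : R; qjm : R; qkm : R }.

Section QuaternionChoice.
Variable R : Type.
Definition quat_to_prod (q : quaternion R) := (qre q, qim q, qjm q, qkm q).
Definition quat_of_prod (p : R * R * R * R) :=
  let: (a, b, c, d) := p in Quat a b c d.
Lemma quat_to_prodK : cancel quat_to_prod quat_of_prod.
Proof. by case. Qed.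
End QuaternionChoice.

HB.instance Definition _ (R : eqType) :=
  Equality.copy (quaternion R) (can_type (@quat_to_prodK R)).
HB.instance Definition _ (R : choiceType) :=
  Choice.copy (quaternion R) (can_type (@quat_to_prodK R)).

Section QuaternionRing.
Variable R : comNzRingType.
Implicit Types p q r : quaternion R.

Definition addq p q :=
  Quat (qre p + qre q) (qim p + qim q) (qjm p + qjm q) (qkm p + qkm q).
Definition oppq q := Quat (- qre q) (- qim q) (- qjm q) (- qkm q).
Definition zeroq : quaternion R := Quat 0 0 0 0.
Definition oneq : quaternion R := Quat 1 0 0 0.
Definition mulq p q :=
  let: Quat a b c d := p in
  let: Quat a' b' c' d' := q in
  Quat (a * a' - b * b' - c * c' - d * d')
       (a * b' + b * a' + c * d' - d * c')
       (a * c' - b * d' + c * a' + d * b')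
       (a * d' + b * c' - c * b' + d * a').

Fact addqA : associative addq.
Proof. by move=> [????] [????] [????]; congr Quat => /=; ring. Qed.
Fact addqC : commutative addq.
Proof. by move=> [????] [????]; congr Quat => /=; ring. Qed.
Fact add0q : left_id zeroq addq.
Proof. by move=> [????]; congr Quat => /=; ring. Qed.
Fact addNq : left_inverse zeroq oppq addq.
Proof. by move=> [????]; congr Quat => /=; ring. Qed.

HB.instance Definition _ :=
  GRing.isZmodule.Build (quaternion R) addqA addqC add0q addNq.

Fact mulqA : associative mulq.
Proof. by move=> [????] [????] [????]; congr Quat => /=; ring. Qed.
Fact mul1q : left_id oneq mulq.
Proof. by move=> [????]; congr Quat => /=; ring. Qed.
Fact mulq1 : right_id oneq mulq.
Proof. by move=> [????]; congr Quat => /=; ring. Qed.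
Fact mulqDl : left_distributive mulq addq.
Proof. by move=> [????] [????] [????]; congr Quat => /=; ring. Qed.
Fact mulqDr : right_distributive mulq addq.
Proof. by move=> [????] [????] [????]; congr Quat => /=; ring. Qed.
Fact oneq_neq0 : oneq != 0.
Proof. by apply/eqP => /(congr1 (@qre R))/eqP; rewrite oner_eq0. Qed.

HB.instance Definition _ :=
  GRing.Zmodule_isNzRing.Build (quaternion R)
    mulqA mul1q mulq1 mulqDl mulqDr oneq_neq0.

Definition conjq q := Quat (qre q) (- qim q) (- qjm q) (- qkm q).

(* The decomposition q = quat_fst q + quat_snd q * j with complex parts;
   note (d i) j = d k. *)
Definition quat_fst q : R[i] := Complex (qre q) (qim q).
Definition quat_snd q : R[i] := Complex (qjm q) (qkm q).

Definition quat_of_complex (z : R[i]) : quaternion R :=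
  Quat (complex.Re z) (complex.Im z) 0 0.

End QuaternionRing.

Section QuaternionMatrix.
Variable R : realType.
Local Notation H := (quaternion R).

Definition absq (q : H) : R :=
  Num.sqrt (qre q ^+ 2 + qim q ^+ 2 + qjm q ^+ 2 + qkm q ^+ 2).

Definition adjmx m n (A : 'M[H]_(m, n)) : 'M[H]_(n, m) :=
  \matrix_(i, j) conjq (A j i).

Definition normal_qmx n (A : 'M[H]_n) : Prop :=
  A *m adjmx A = adjmx A *m A.

Definition unitary_qmx n (A : 'M[H]_n) : Prop :=
  A *m adjmx A = 1%:M /\ adjmx A *m A = 1%:M.

(* [invmx] and [unitmx] require commutative coefficients. *)
Definition inverse_of n (A B : 'M[H]_n) : Prop :=
  A *m B = 1%:M /\ B *m A = 1%:M.

Definition nonsingular n (A : 'M[H]_n) : Prop := exists B, inverse_of A B.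

(* The inverse of [A] if [A] is nonsingular, and [A] itself otherwise. *)
Definition invqmx n (A : 'M[H]_n) : 'M[H]_n := xget A [set B | inverse_of A B]%classic.

Lemma invqmxP n (A : 'M[H]_n) : nonsingular A -> inverse_of A (invqmx A).
Proof. by case=> B AB; exact: (@xgetPex _ A [set B | inverse_of A B]%classic (ex_intro _ B AB)). Qed.

Definition vnorm n (x : 'cV[H]_n) : R :=
  Num.sqrt (\sum_(i < n) absq (x i 0) ^+ 2).

Definition spectral_norm n (A : 'M[H]_n) : R :=
  sup [set r : R | exists2 x : 'cV[H]_n,
         x != 0 & r = vnorm (A *m x) / vnorm x]%classic.

Definition frobenius_norm m n (A : 'M[H]_(m, n)) : R :=
  Num.sqrt (\sum_(i < m) \sum_(j < n) absq (A i j) ^+ 2).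

Definition chi_mx n (A : 'M[H]_n) : 'M[R[i]]_(n + n) :=
  let A' := map_mx (@quat_fst R) A in
  let A'' := map_mx (@quat_snd R) A in
  block_mx A' A'' (- map_mx (@conjc R) A'') (map_mx (@conjc R) A').

(* [lam] lists the standard eigenvalues of [A], in some order and with
   multiplicity. *)
Definition standard_eigenvalues n (A : 'M[H]_n) (lam : 'I_n -> R[i]) : Prop :=
  (forall i, 0 <= complex.Im (lam i)) /\
  char_poly (chi_mx A) =
    (\prod_(i < n) ('X - (lam i)%:P)) * (\prod_(i < n) ('X - (conjc (lam i))%:P)).

Definition complex_diag n (lam : 'I_n -> R[i]) : 'M[H]_n :=
  diag_mx (\row_(i < n) quat_of_complex (lam i)).

(* Block companion matrix of the monic polynomial I x^2 + C1 x + C0. *)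
Definition companion2 n (C0 C1 : 'M[H]_n) : 'M[H]_(n + n) :=
  block_mx 0 1%:M (- C0) (- C1).

End QuaternionMatrix.

(* Main.v *)
(* The block companion matrix C_Q is normal, so this is a Hoffman-Wielandt
   inequality for a diagonalizable matrix A = X L X^-1 and a normal matrix B,
   transported to complex matrices by chi.  Write X^-1 = V^* h W with V, W
   unitary and h a positive diagonal matrix, and put N1 = V L V^*,
   N2 = W B W^*; then X^-1 (A - B) and N1 h - h N2 have the same Frobenius norm.
   Rows and columns of a normal matrix have equal norms, so h_i^2 and h_j^2 can
   be exchanged in the expansion of |N1 h - h N2|^2, which is therefore at least
   the sum of h_i h_j |(N1 - N2)_ij|^2; and h_i >= 1 / |X|_2.  For the normal
   matrices N1, N2 the norm |N1 - N2|^2 is an average of the squared eigenvalue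
   distances with unistochastic weights.  As |l - m| <= |l - conj m| when l and
   m have nonnegative imaginary parts, the weights fold onto the standard
   eigenvalues, and a permutation does at least as well as any doubly stochastic
   matrix. *)

Require Import Defs.
From mathcomp Require Import all_boot all_order all_algebra all_fingroup.
From mathcomp Require Import ring lra.
From mathcomp Require Import complex reals.

Set Implicit Arguments.
Unset Strict Implicit.
Unset Printing Implicit Defensive.

Import Order.TTheory GRing.Theory Num.Theory.
Local Open Scope ring_scope.

(** * Hall's marriage theorem for finite families of finite sets *)

Section HallMarriage.
Local Open Scope nat_scope.

Definition hall_condition (T U : finType) (N : T -> {set U}) :=
  forall A : {set T}, #|A| <= #|\bigcup_(i in A) N i|.

Definition shrink (T U : finType) (N : T -> {set U}) (i0 : T) (x : U) :=
  fun i => if i == i0 then N i :\ x else N i.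

(* If both removals broke Hall's condition, at sets [A] and [B] say, then
   submodularity would contradict Hall's condition on [A :|: B] and on
   [(A :&: B) :\ i0]. *)
Lemma hall_condition_shrink (T U : finType) (N : T -> {set U}) (i0 : T)
    (x y : U) :
  hall_condition N -> x != y ->
  hall_condition (shrink N i0 x) \/ hall_condition (shrink N i0 y).
Proof.
move=> hN xy.
have [/forallP hx|/forallPn[A]] :=
    boolP [forall A : {set T}, #|A| <= #|\bigcup_(i in A) shrink N i0 x i|].
  by left.
have [/forallP hy|/forallPn[B]] :=
    boolP [forall A : {set T}, #|A| <= #|\bigcup_(i in A) shrink N i0 y i|].
  by right.
rewrite -!ltnNge.
set NB := \bigcup_(i in B) _; set NA := \bigcup_(i in A) _ => ltB ltA.
have i0in z (D : {set T}) :
    #|\bigcup_(i in D) shrink N i0 z i| < #|D| -> i0 \in D.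
  move=> ltD; apply/negPn/negP => i0D.
  suff eqD : \bigcup_(i in D) shrink N i0 z i = \bigcup_(i in D) N i.
    by have := hN D; rewrite leqNgt -eqD ltD.
  apply: eq_bigr => i iD; rewrite /shrink.
  by case: eqP => // ei; rewrite -ei iD in i0D.
have i0A := i0in _ _ ltA; have i0B := i0in _ _ ltB.
(* An element of [N i0] cannot equal both [x] and [y], so it survives at least one of the two
   removals. *)
have subU : \bigcup_(i in A :|: B) N i \subset NA :|: NB.
  apply/subsetP => u /bigcupP[i iAB uNi]; rewrite inE.
  have [ei|ni] := eqVneq i i0; last first.
    case/setUP: iAB => iD; apply/orP; [left|right];
      by apply/bigcupP; exists i; rewrite // /shrink (negPf ni).
  have [ux|nux] := eqVneq u x; apply/orP; [right|left];
    apply/bigcupP; exists i0; rewrite // /shrink eqxx -ei !inE uNi andbT //.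
  by rewrite ux.
have subI : \bigcup_(i in (A :&: B) :\ i0) N i \subset NA :&: NB.
  apply/subsetP => u /bigcupP[i /setD1P[ni /setIP[iA iB]] uNi].
  by rewrite inE; apply/andP; split; apply/bigcupP; exists i;
    rewrite // /shrink (negPf ni).
have := leq_add (leq_trans (hN _) (subset_leq_card subU))
                (leq_trans (hN _) (subset_leq_card subI)).
(* Dropping [i0] from the intersection costs one, but the strict inequalities for [A] and [B]
   together gain two. *)
have cI : #|A :&: B| = #|(A :&: B) :\ i0|.+1.
  by rewrite (cardsD1 i0 (A :&: B)) inE i0A i0B.
rewrite cardsUI => le1; have := leq_add ltA ltB.
by rewrite -(cardsUI A B) cI !(addnS, addSn) ltnS => /leq_trans/(_ le1); rewrite ltnn.
Qed.

(** Induction on the total size of the sets: while some [N i0] has two elements, one of them can be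
    removed. Once no set has two, Hall's condition on singletons makes every [N i] a singleton, and
    on pairs it makes these distinct. *)
Lemma hall_marriage (T U : finType) (N : T -> {set U}) :
  hall_condition N -> exists2 f : T -> U, injective f & forall i, f i \in N i.
Proof.
have [k] := ubnP (\sum_i #|N i|); elim: k N => // k IH N leN hN.
have [/existsP[i0 /card_gt1P[x [y [xN yN xy]]]]|/existsPn N1] :=
    boolP [exists i, 1 < #|N i|].
  have shrinkP z : z \in N i0 -> hall_condition (shrink N i0 z) ->
      exists2 f : T -> U, injective f & forall i, f i \in N i.
    move=> zN /IH[].
      rewrite -ltnS (leq_trans _ leN) // ltnS (bigD1 i0) //= [leqRHS](bigD1 i0) //=.
      rewrite {1}/shrink eqxx [X in _ < X + _](cardsD1 z) zN !addSn ltnS leq_add2l.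
      by apply: leq_sum => i ni; rewrite /shrink (negPf ni).
    move=> f f_inj fN; exists f => // i; have := fN i; rewrite /shrink.
    by case: eqP => // _ /setD1P[].
  by case: (hall_condition_shrink i0 hN xy); apply: shrinkP.
have Nsing i : exists u, N i == [set u].
  suff /cards1P[u ->] : #|N i| == 1 by exists u.
  by rewrite eqn_leq leqNgt N1 /=; have := hN [set i]; rewrite big_set1 cards1.
exists (fun i => xchoose (Nsing i)) => [i j /= eij|i]; last first.
  by rewrite {2}(eqP (xchooseP (Nsing i))) inE.
apply/eqP/negPn/negP => nij; have := hN [set i; j].
rewrite bigcup_setU !big_set1 (eqP (xchooseP (Nsing i))).
by rewrite (eqP (xchooseP (Nsing j))) eij setUid cards1 cards2 nij.
Qed.
End HallMarriage.

(** * Optimal assignment against scaled doubly stochastic matrices *)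

Section Birkhoff.
Variables (R : realFieldType) (T : finType).
Implicit Types (p c : T -> T -> R) (s : R).

(** The rows in [A] carry mass [s * #|A|], all of it in columns of the neighbourhood of [A], whose
    total mass is [s] times their number. This is Hall's condition for the support of [p]. *)
Lemma stochastic_support_perm p s : 0 < s -> (forall i j, 0 <= p i j) ->
  (forall i, \sum_j p i j = s) -> (forall j, \sum_i p i j = s) ->
  exists pi : {perm T}, forall i, 0 < p i (pi i).
Proof.
move=> s0 p0 rows cols; pose N i := [set j | 0 < p i j].
have [A|f f_inj fN] := @hall_marriage T T N.
  rewrite -(ler_nat R) -(ler_pM2r s0) !mulr_natl -!sumr_const.
  rewrite (eq_bigr _ (fun i _ => esym (rows i))).
  rewrite [leRHS](eq_bigr _ (fun j _ => esym (cols j))).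
  have -> : \sum_(i in A) \sum_j p i j =
            \sum_(i in A) \sum_(j in \bigcup_(i in A) N i) p i j.
    apply: eq_bigr => i iA; rewrite (bigID (mem (\bigcup_(i in A) N i))) /=.
    rewrite [X in _ + X]big1 ?addr0 // => j /bigcupP nj; apply/eqP.
    rewrite eq_le p0 andbT leNgt; apply/negP => pij.
    by apply: nj; exists i; rewrite // inE.
  rewrite exchange_big; apply: ler_sum => j _ /=.
  by rewrite [leRHS](bigID (mem A)) /= lerDl sumr_ge0.
by exists (perm f_inj) => i; rewrite permE; have := fN i; rewrite inE.
Qed.

(** The witness is a cheapest permutation, chosen independently of [p]. Multiples of permutation
    matrices are then peeled off [p] by induction on the size of its support; the common sum [s] is
    arbitrary because each peeling lowers it. *)
Lemma assignment_le_stochastic p c s : 0 <= s -> (forall i j, 0 <= p i j) ->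
  (forall i, \sum_j p i j = s) -> (forall j, \sum_i p i j = s) ->
  exists pi : {perm T}, s * (\sum_i c i (pi i)) <= \sum_i \sum_j c i j * p i j.
Proof.
pose cost (pi : {perm T}) := \sum_i c i (pi i).
pose pi0 := [arg min_(pi < (1%g : {perm T})) cost pi]%O.
have pi0_min pi : cost pi0 <= cost pi.
  by rewrite /pi0; case: arg_minP => // ? _; apply.
move=> s0 p0 rows cols; exists pi0; rewrite -/(cost pi0).
have [k] := ubnP #|[set ij : T * T | p ij.1 ij.2 != 0]|.
elim: k p s s0 p0 rows cols => // k IH p s s0 p0 rows cols lek.
have [sp|] := ltP 0 s; last first.
  move=> s_le0; have -> : s = 0 by apply/eqP; rewrite eq_le s_le0.
  rewrite mul0r big1 // => i _; rewrite big1 // => j _.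
  have : \sum_j p i j <= 0 by rewrite rows.
  move=> le0; suff -> : p i j = 0 by rewrite mulr0.
  apply/eqP; rewrite eq_le p0 andbT (le_trans _ le0) //.
  by rewrite (bigD1 j) //= lerDl sumr_ge0.
have [pi pi_gt0] := stochastic_support_perm sp p0 rows cols.
have [i0 _|T0] := pickP (fun _ : T => true); last first.
  by rewrite /cost !big1 ?mulr0 // => i; have := T0 i.
(* The smallest entry along [pi] is the largest multiple of its permutation matrix that leaves [p]
   nonnegative; subtracting it removes [(im, pi im)] from the support. *)
pose im := [arg min_(i < i0) p i (pi i)]%O.
have im_min i : p im (pi im) <= p i (pi i).
  by rewrite /im; case: arg_minP => // ? _; apply.
set e := p im (pi im); have e0 : 0 < e by apply: pi_gt0.
pose q i j := p i j - e * (j == pi i)%:R.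
have q0 i j : 0 <= q i j.
  by rewrite /q subr_ge0; case: eqP => [->|_]; rewrite ?mulr1 ?mulr0 ?p0.
have rq i : \sum_j q i j = s - e.
  rewrite sumrB rows -mulr_sumr (bigD1 (pi i)) //= eqxx big1 ?addr0 ?mulr1 //.
  by move=> j /negPf ->.
have cq j : \sum_i q i j = s - e.
  rewrite sumrB cols -mulr_sumr (bigD1 ((pi^-1)%g j)) //= permKV eqxx big1.
    by rewrite addr0 mulr1.
  by move=> i ni; rewrite -(inj_eq (@perm_inj _ (pi^-1)%g)) permK eq_sym (negPf ni).
have se : 0 <= s - e by rewrite -(rq i0) sumr_ge0.
have := IH q (s - e) se q0 rq cq _; rewrite mulrBl => IHq.
have {IHq} : s * cost pi0 - e * cost pi0 <= \sum_i \sum_j c i j * q i j.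
  apply: IHq; rewrite -ltnS (leq_trans _ lek) // ltnS; apply: proper_card.
  apply/properP; split; last first.
    by exists (im, pi im); rewrite inE /q /= ?eqxx ?mulr1 -/e ?subrr ?eqxx ?gt_eqF.
  apply/subsetP => -[i j]; rewrite !inE /=; apply: contra_neq => pij.
  rewrite /q pij (_ : j == pi i = false) ?mulr0 ?subr0 //.
  by apply: contraTF (pi_gt0 i) => /eqP <-; rewrite pij ltxx.
have -> : \sum_i \sum_j c i j * q i j =
    \sum_i \sum_j c i j * p i j - e * cost pi.
  rewrite mulr_sumr -sumrB; apply: eq_bigr => i _.
  rewrite (eq_bigr (fun j => c i j * p i j - e * (c i j * (j == pi i)%:R))).
    rewrite sumrB -mulr_sumr; congr (_ - e * _).
    rewrite (bigD1 (pi i)) //= eqxx mulr1 big1 ?addr0 // => j /negPf ->.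
    by rewrite mulr0.
  by move=> j _; rewrite /q mulrBr mulrCA.
by have := ler_wpM2l (ltW e0) (pi0_min pi); lra.
Qed.
End Birkhoff.

(** * Frobenius estimates and a Hoffman-Wielandt inequality for complex matrices *)

Section ComplexMatrix.
Variable C : numClosedFieldType.
Local Open Scope sesquilinear_scope.

Definition fro2 m n (A : 'M[C]_(m, n)) : C := \sum_i \sum_j `|A i j| ^+ 2.

Lemma trmxC_mul m n p (A : 'M[C]_(m, n)) (B : 'M_(n, p)) :
  (A *m B)^t* = B^t* *m A^t*.
Proof. by rewrite trmx_mul map_mxM. Qed.

Lemma mulmx_adj_diag m n (A : 'M[C]_(m, n)) i :
  (A *m A^t*) i i = \sum_j `|A i j| ^+ 2.
Proof. by rewrite mxE; apply: eq_bigr => j _; rewrite !mxE normCK. Qed.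

Lemma adj_mulmx_diag m n (A : 'M[C]_(m, n)) j :
  (A^t* *m A) j j = \sum_i `|A i j| ^+ 2.
Proof. by rewrite mxE; apply: eq_bigr => i _; rewrite !mxE normCKC. Qed.

Lemma fro2_mxtrace m n (A : 'M[C]_(m, n)) : fro2 A = \tr (A *m A^t*).
Proof. by apply: eq_bigr => i _; rewrite mulmx_adj_diag. Qed.

Lemma fro2_adj m n (A : 'M[C]_(m, n)) : fro2 (A^t*) = fro2 A.
Proof.
rewrite /fro2 exchange_big; apply: eq_bigr => i _; apply: eq_bigr => j _.
by rewrite !mxE norm_conjC.
Qed.

Lemma fro2_mulr_unitary m n (A : 'M[C]_(m, n)) (U : 'M_n) :
  U \is unitarymx -> fro2 (A *m U) = fro2 A.
Proof. by move=> uU; rewrite !fro2_mxtrace trmxC_mul mulmxA mulmxtVK. Qed.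

Lemma fro2_mull_unitary m n (A : 'M[C]_(m, n)) (U : 'M_m) :
  U \is unitarymx -> fro2 (U *m A) = fro2 A.
Proof.
move=> uU; rewrite -fro2_adj trmxC_mul fro2_mulr_unitary ?fro2_adj //.
by rewrite trmxC_unitary.
Qed.

Lemma fro2_col m n (A : 'M[C]_(m, n)) : fro2 A = \sum_j fro2 (col j A).
Proof.
rewrite /fro2 exchange_big; apply: eq_bigr => j _; apply: eq_bigr => i _.
by rewrite big_ord1 mxE.
Qed.

(** The squared Frobenius norm adds up over columns, so an operator bound on vectors passes to
    matrices. *)
Lemma fro2_mulmx_le_bound m n p (A : 'M[C]_(m, n)) (B : 'M_(n, p)) k :
  (forall x : 'cV_n, fro2 (A *m x) <= k * fro2 x) ->
  fro2 (A *m B) <= k * fro2 B.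
Proof.
move=> kA; rewrite (fro2_col (A *m B)) (fro2_col B) mulr_sumr.
by apply: ler_sum => j _; rewrite !colE -mulmxA -!colE kA.
Qed.

Lemma fro2_mulmx m n p (A : 'M[C]_(m, n)) (B : 'M_(n, p)) :
  fro2 (A *m B) <= fro2 A * fro2 B.
Proof.
apply: fro2_mulmx_le_bound => x; rewrite /fro2 mulr_suml; apply: ler_sum => i _.
rewrite big_ord1.
have /= := CauchySchwarz (@dotmx C n) (row i A) (x^t*).
rewrite !dotmxE trmxCK -row_mul !mxE => /leif_le/le_trans->//.
rewrite le_eqVlt; apply/predU1P; left; congr (_ * _).
all: apply: eq_bigr => j _; rewrite ?big_ord1 !mxE normCK //.
by rewrite mulrC.
Qed.

(** Singular value decomposition: [V] diagonalizes [A *m A^t*], [h] holds the square roots of the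
    eigenvalues, and [W] is [V *m A] with its rows normalized. *)
Lemma svd_unitmx n (A : 'M[C]_n) : A \in unitmx ->
  exists V W (h : 'rV[C]_n), [/\ V \is unitarymx, W \is unitarymx,
    forall i, 0 < h 0 i & V *m A = diag_mx h *m W].
Proof.
move=> uA; pose G := A *m A^t*.
have /orthomx_spectralP GE : G \is normalmx.
  by apply/normalmxP; rewrite /G trmxC_mul trmxCK.
set V := spectralmx G in GE; set sp := spectral_diag G in GE.
have uV : V \is unitarymx := spectral_unitarymx G.
have VG : (V *m A) *m (V *m A)^t* = diag_mx sp.
  rewrite trmxC_mul !mulmxA -(mulmxA V A) -/G GE !mulmxA mulmxV ?unitarymx_unit //.
  by rewrite mul1mx mulmxtVK.
(* This eigenvalue is the squared norm of row [i] of the invertible matrix [V *m A]. *)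
have sp_gt0 i : 0 < sp 0 i.
  have <- : (diag_mx sp) i i = sp 0 i by rewrite mxE eqxx.
  rewrite -VG mulmx_adj_diag lt0r; apply/andP; split; last first.
    by apply: sumr_ge0 => j _; rewrite exprn_ge0.
  apply/eqP => /psumr_eq0P VA0.
  have : row i (V *m A) == 0.
    apply/eqP/rowP => j; rewrite !mxE; apply/eqP.
    by have /eqP := VA0 (fun j _ => exprn_ge0 _ (normr_ge0 _)) j isT;
      rewrite sqrf_eq0 normr_eq0 mxE.
  rewrite rowE mulmx_free_eq0 ?row_free_unit ?unitmx_mul ?(unitarymx_unit uV) ?uA //.
  by move/eqP/rowP/(_ i)/eqP; rewrite !mxE !eqxx oner_eq0.
pose h : 'rV[C]_n := \row_i sqrtC (sp 0 i).
pose h' : 'rV[C]_n := \row_i (sqrtC (sp 0 i))^-1.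
have h_gt0 i : 0 < h 0 i by rewrite mxE sqrtC_gt0.
exists V, (diag_mx h' *m (V *m A)), h; split => //; last first.
  rewrite mulmxA mulmx_diag [X in diag_mx X](_ : _ = const_mx 1).
    by rewrite diag_const_mx mul1mx.
  by apply/rowP => i; rewrite !mxE divff // gt_eqF // sqrtC_gt0.
apply/unitarymxP; rewrite trmxC_mul mulmxA -(mulmxA (diag_mx h')) VG.
rewrite tr_diag_mx map_diag_mx !mulmx_diag -diag_const_mx; congr diag_mx.
apply/rowP => i; rewrite !mxE /= geC0_conj ?invr_ge0 ?sqrtC_ge0 ?ltW //.
by rewrite -{2}(sqrtCK (sp 0 i)) expr2 mulKf ?divff ?gt_eqF ?sqrtC_gt0.
Qed.

Lemma normalmx_row_col n (A : 'M[C]_n) i : A \is normalmx ->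
  \sum_j `|A i j| ^+ 2 = \sum_j `|A j i| ^+ 2.
Proof. by move=> /normalmxP nA; rewrite -mulmx_adj_diag nA adj_mulmx_diag. Qed.

(** Normality allows both [h 0 i ^+ 2] and [h 0 j ^+ 2] to be replaced by their mean. The two sides
    then differ, entry by entry, by [(h 0 i - h 0 j) ^+ 2 / 2] times a sum of squared moduli. *)
Lemma normal_diag_intertwine n (A B : 'M[C]_n) (h : 'rV[C]_n) :
  A \is normalmx -> B \is normalmx -> (forall i, 0 <= h 0 i) ->
  \sum_i \sum_j h 0 i * h 0 j * `|A i j - B i j| ^+ 2 <=
  fro2 (A *m diag_mx h - diag_mx h *m B).
Proof.
move=> nA nB h_ge0.
have swap (M : 'M[C]_n) : M \is normalmx ->
    \sum_i \sum_j h 0 i ^+ 2 * `|M i j| ^+ 2 =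
    \sum_i \sum_j h 0 j ^+ 2 * `|M i j| ^+ 2.
  move=> nM; rewrite [RHS]exchange_big; apply: eq_bigr => i _ /=.
  by rewrite -!mulr_sumr normalmx_row_col.
have hr i : (h 0 i)^* = h 0 i by rewrite geC0_conj.
pose r i j := A i j * (B i j)^* + B i j * (A i j)^*.
have -> : fro2 (A *m diag_mx h - diag_mx h *m B) =
    \sum_i \sum_j ((h 0 i ^+ 2 + h 0 j ^+ 2) / 2%:R *
      (`|A i j| ^+ 2 + `|B i j| ^+ 2) - h 0 i * h 0 j * r i j).
  have E : fro2 (A *m diag_mx h - diag_mx h *m B) =
    \sum_i \sum_j h 0 j ^+ 2 * `|A i j| ^+ 2 +
    \sum_i \sum_j h 0 i ^+ 2 * `|B i j| ^+ 2 -
    \sum_i \sum_j h 0 i * h 0 j * r i j.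
    rewrite -big_split -sumrB /=; apply: eq_bigr => i _.
    rewrite -big_split -sumrB /=; apply: eq_bigr => j _.
    rewrite mul_mx_diag mul_diag_mx !mxE !normCK !rmorphB !rmorphM /= !hr /r; ring.
  rewrite E.
  have half (M : 'M[C]_n) : M \is normalmx ->
      \sum_i \sum_j h 0 j ^+ 2 * `|M i j| ^+ 2 =
      \sum_i \sum_j (h 0 i ^+ 2 + h 0 j ^+ 2) / 2%:R * `|M i j| ^+ 2.
    move=> nM; apply: (@mulfI _ 2%:R); first by rewrite pnatr_eq0.
    rewrite mulr_natl mulr2n -{1}swap // -big_split mulr_sumr /=.
    apply: eq_bigr => i _; rewrite -big_split mulr_sumr /=.
    by apply: eq_bigr => j _; field.
  rewrite swap // half // half // -big_split -sumrB /=; apply: eq_bigr => i _.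
  rewrite -big_split -sumrB /=; apply: eq_bigr => j _; ring.
apply: ler_sum => i _; apply: ler_sum => j _.
rewrite -subr_ge0.
have -> : (h 0 i ^+ 2 + h 0 j ^+ 2) / 2%:R *
      (`|A i j| ^+ 2 + `|B i j| ^+ 2) - h 0 i * h 0 j * r i j -
      h 0 i * h 0 j * `|A i j - B i j| ^+ 2 =
  (h 0 i - h 0 j) ^+ 2 / 2%:R * (`|A i j| ^+ 2 + `|B i j| ^+ 2).
  by rewrite !normCK rmorphB /= /r; field.
rewrite mulr_ge0 ?addr_ge0 ?exprn_ge0 // divr_ge0 ?ler0n //.
by rewrite real_exprn_even_ge0 // rpredB // ger0_real.
Qed.

(** The constants [x2] and [y2] stand for squared spectral norms. The conclusion keeps the
    unistochastic weights instead of a permutation, because conjugate pairs have to be folded before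
    a permutation is chosen. *)
Lemma hoffman_wielandt_diagonalizable n (A B X Y : 'M[C]_n) (l : 'rV[C]_n)
    (x2 y2 : C) :
  0 <= x2 -> B \is normalmx -> X *m Y = 1%:M -> Y *m A *m X = diag_mx l ->
  (forall x : 'cV_n, fro2 (X *m x) <= x2 * fro2 x) ->
  (forall x : 'cV_n, fro2 (Y *m x) <= y2 * fro2 x) ->
  exists2 Z : 'M[C]_n, Z \is unitarymx &
    \sum_i \sum_j `|l 0 i - spectral_diag B 0 j| ^+ 2 * `|Z i j| ^+ 2 <=
    x2 * y2 * fro2 (A - B).
Proof.
move=> x2_ge0 nB XY YAX x2P y2P.
have YX := mulmx1C XY.
have [_ uY] := mulmx1_unit XY.
have [V [W [h [uV uW h_gt0 VY]]]] := svd_unitmx uY.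
set P := spectralmx B; set sp := spectral_diag B.
have uP : P \is unitarymx := spectral_unitarymx B.
have BE : B = P^t* *m diag_mx sp *m P.
  by rewrite -invmx_unitary //; exact/orthomx_spectralP.
pose N1 := V *m diag_mx l *m V^t*; pose N2 := W *m B *m W^t*.
have nN1 : N1 \is normalmx.
  apply/normalmxP; rewrite /N1 !trmxC_mul trmxCK !mulmxA.
  rewrite !(mulmxKtV _ uV) // tr_diag_mx map_diag_mx -!(mulmxA V) !mulmx_diag.
  by congr (V *m (diag_mx _ *m _)); apply/rowP => i; rewrite !mxE mulrC.
have nN2 : N2 \is normalmx.
  apply/normalmxP; rewrite /N2 !trmxC_mul trmxCK !mulmxA !(mulmxKtV _ uW) //.
  by rewrite -!(mulmxA W) (normalmxP nB).
exists (V^t* *m W *m P^t*).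
  by rewrite !mul_unitarymx ?trmxC_unitary.
(* The matrix [G] inverts [diag_mx h], so its diagonal entry is the inverse of [h 0 k]. Column [k]
   of [G] is, up to a unitary factor, [X] applied to a unit vector, hence has squared norm at most
   [x2]. *)
have h_bound k : 1 <= x2 * h 0 k ^+ 2.
  pose G := W *m X *m V^t*.
  have hG : diag_mx h *m G = 1%:M.
    rewrite /G !mulmxA -VY -(mulmxA V) YX mulmx1; exact/unitarymxP.
  have Gk : h 0 k * G k k = 1.
    by have /matrixP/(_ k k) := hG; rewrite mul_diag_mx !mxE eqxx.
  have : fro2 (col k G) <= x2.
    rewrite /G colE -!mulmxA fro2_mull_unitary // (le_trans (x2P _)) //.
    rewrite fro2_mull_unitary ?trmxC_unitary //.
    rewrite /fro2 (bigD1 k) //= big_ord1 mxE !eqxx big1.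
      by rewrite normr1 expr1n addr0 mulr1.
    by move=> i nik; rewrite big_ord1 mxE (negPf nik) normr0 expr0n.
  move=> le_x2; have : `|G k k| ^+ 2 <= x2.
    rewrite (le_trans _ le_x2) // /fro2 (bigD1 k) //= big_ord1.
    rewrite [X in _ <= X + _](_ : _ = `|G k k| ^+ 2) ?lerDl; last by rewrite mxE.
    by apply: sumr_ge0 => i _; apply: sumr_ge0 => j _; rewrite exprn_ge0.
  move=> /(ler_wpM2r (exprn_ge0 2 (ltW (h_gt0 k)))); apply: le_trans.
  by rewrite -{1}(gtr0_norm (h_gt0 k)) -exprMn -normrM mulrC Gk normr1 expr1n.
(* The square of this quantity is the product of the bounds for [i] and [j]. *)
have hh_bound i j : 1 <= x2 * (h 0 i * h 0 j).
  have hh_ge0 : 0 <= h 0 i * h 0 j by rewrite mulr_ge0 ?ltW.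
  rewrite -(@expr_ge1 _ 2) ?(mulr_ge0 x2_ge0 hh_ge0) //.
  have -> : (x2 * (h 0 i * h 0 j)) ^+ 2 = (x2 * h 0 i ^+ 2) * (x2 * h 0 j ^+ 2).
    by ring.
  by rewrite mulr_ege1.
have hE : diag_mx h = V *m Y *m W^t* by rewrite VY mulmxtVK.
have N12E : N1 *m diag_mx h - diag_mx h *m N2 = V *m (Y *m (A - B)) *m W^t*.
  rewrite hE /N1 /N2 !mulmxA !(mulmxKtV _ _) // -YAX !mulmxA.
  by rewrite -(mulmxA _ X Y) XY mulmx1 mulmxBr mulmxBl.
set Z := V^t* *m W *m P^t*.
(* In eigenbases of [N1] and [N2] the difference has entries [(l 0 i - sp 0 j) * Z i j], which turns
   its norm into the weighted sum. *)
have ZE : V^t* *m (N1 - N2) *m (W *m P^t*) = diag_mx l *m Z - Z *m diag_mx sp.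
  have VV : V^t* *m V = 1%:M by rewrite -[V^t*]mul1mx mulmxKtV.
  have BP : B *m P^t* = P^t* *m diag_mx sp by rewrite {1}BE mulmxtVK.
  rewrite /Z /N1 /N2 mulmxBr mulmxBl !mulmxA VV mul1mx !(mulmxKtV _ _) //.
  by rewrite -!mulmxA BP.
clearbody Z.
have -> : \sum_i \sum_j `|l 0 i - sp 0 j| ^+ 2 * `|Z i j| ^+ 2 = fro2 (N1 - N2).
  rewrite -(@fro2_mull_unitary _ _ (N1 - N2) (V^t*)) ?trmxC_unitary //.
  rewrite -(@fro2_mulr_unitary _ _ _ (W *m P^t*)) ?mul_unitarymx ?trmxC_unitary //.
  rewrite ZE; apply: eq_bigr => i _; apply: eq_bigr => j _.
  by rewrite mul_mx_diag mul_diag_mx !mxE -exprMn -normrM mulrBl [_ * sp 0 j]mulrC.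
have le1 : fro2 (N1 - N2) <=
    x2 * \sum_i \sum_j h 0 i * h 0 j * `|N1 i j - N2 i j| ^+ 2.
  rewrite mulr_sumr; apply: ler_sum => i _; rewrite mulr_sumr.
  by apply: ler_sum => j _; rewrite !mxE mulrA ler_peMl ?exprn_ge0.
apply: (le_trans le1); rewrite -mulrA ler_wpM2l //.
apply: (le_trans (normal_diag_intertwine nN1 nN2 _)) => [i|]; first exact: ltW.
rewrite N12E fro2_mulr_unitary ?trmxC_unitary // fro2_mull_unitary //.
exact: fro2_mulmx_le_bound.
Qed.

Lemma char_poly_diag_mx n (d : 'rV[C]_n) :
  char_poly (diag_mx d) = \prod_i ('X - (d 0 i)%:P).
Proof.
rewrite char_poly_trig ?diag_mx_is_trig //.
by apply: eq_bigr => i _; rewrite mxE eqxx.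
Qed.

Lemma char_poly_similar n (P A : 'M[C]_n) : P \in unitmx ->
  char_poly (invmx P *m A *m P) = char_poly A.
Proof.
move=> uP; rewrite /char_poly.
have -> : char_poly_mx (invmx P *m A *m P) =
    map_mx polyC (invmx P) *m char_poly_mx A *m map_mx polyC P.
  rewrite /char_poly_mx mulmxBr mulmxBl !map_mxM; congr (_ - _).
  by rewrite scalar_mxC -mulmxA -map_mxM mulVmx // map_mx1 mulmx1.
by rewrite !det_mulmx mulrAC -det_mulmx -map_mxM mulVmx // map_mx1 det1 mul1r.
Qed.

(** [A] is similar to its spectral diagonal, so both lists are the roots of one polynomial and agree
    up to order by unique factorization. *)
Lemma spectral_diag_perm n (A : 'M[C]_n) (r : 'rV[C]_n) : A \is normalmx ->
  char_poly A = \prod_i ('X - (r 0 i)%:P) ->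
  exists t : {perm 'I_n}, forall i, spectral_diag A 0 (t i) = r 0 i.
Proof.
move=> /orthomx_spectralP {1}->; rewrite char_poly_similar ?spectral_unit //.
rewrite char_poly_diag_mx => eq_prod.
have : perm_eq [seq r 0 i | i <- enum 'I_n] [tuple spectral_diag A 0 i | i < n].
  by apply: prod_XsubC_eq; rewrite !big_map -!enumT !big_enum eq_prod.
move=> /tuple_permP[t tE]; exists t => i.
have := congr1 (nth 0 ^~ i) tE.
rewrite -tnth_nth tnth_mktuple tnth_mktuple => <-.
by rewrite (nth_map i) ?nth_ord_enum ?size_enum_ord.
Qed.
End ComplexMatrix.

(** * Folding conjugate pairs of eigenvalues onto the closed upper half-plane *)

Section ConjugatePairs.
Variable R : realType.
Local Notation normc := ComplexField.Normc.normc.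
Local Open Scope complex_scope.

Lemma normc_sqr (z : R[i]) :
  normc z ^+ 2 = complex.Re z ^+ 2 + complex.Im z ^+ 2.
Proof. by case: z => a b; rewrite /= sqr_sqrtr // addr_ge0 ?sqr_ge0. Qed.

(** The squared distances differ by four times the product of the imaginary parts. *)
Lemma normc_sub_conjc (z w : R[i]) : 0 <= complex.Im z -> 0 <= complex.Im w ->
  normc (z - w) ^+ 2 <= normc (z - conjc w) ^+ 2.
Proof. by case: z w => [a b] [c d]; rewrite !normc_sqr /=; nra. Qed.

Lemma normc_conjc (z : R[i]) : normc (conjc z) = normc z.
Proof. by case: z => a b; rewrite /= sqrrN. Qed.

Definition conj_pairs N (lam : 'I_N -> R[i]) : 'rV[R[i]]_(N + N) :=
  row_mx (\row_i lam i) (\row_i conjc (lam i)).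

(* Replacing [mu j] by its conjugate can only move it away from [lam i], so the
   stochastic weights on the [N + N] conjugate pairs may be folded onto the
   representatives of nonnegative imaginary part. *)
Lemma conj_pairs_assignment N (lam mu : 'I_N -> R[i])
    (q : 'I_(N + N) -> 'I_(N + N) -> R) :
  (forall i, 0 <= complex.Im (lam i)) -> (forall i, 0 <= complex.Im (mu i)) ->
  (forall a b, 0 <= q a b) ->
  (forall a, \sum_b q a b = 1) -> (forall b, \sum_a q a b = 1) ->
  exists pi : {perm 'I_N},
    2 * \sum_i normc (lam i - mu (pi i)) ^+ 2 <=
    \sum_a \sum_b normc (conj_pairs lam 0 a - conj_pairs mu 0 b) ^+ 2 * q a b.
Proof.
move=> lam_ge0 mu_ge0 q_ge0 rows cols.
(* Each row or column of [p] merges two rows or columns of [q], hence the common sum 2. *)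
pose p (i j : 'I_N) := q (lshift N i) (lshift N j) + q (lshift N i) (rshift N j) +
  (q (rshift N i) (lshift N j) + q (rshift N i) (rshift N j)).
have [| | |pi le_pi] :=
    @assignment_le_stochastic _ _ p (fun i j => normc (lam i - mu j) ^+ 2) 2 (ler0n _ _).
- by move=> i j; rewrite !addr_ge0.
- move=> i; transitivity (\sum_b q (lshift N i) b + \sum_b q (rshift N i) b).
    by rewrite !big_split_ord !big_split.
  by rewrite !rows; lra.
- move=> j; transitivity (\sum_a q a (lshift N j) + \sum_a q a (rshift N j)).
    by rewrite !big_split_ord !big_split /= addrACA.
  by rewrite !cols; lra.
exists pi; apply: (le_trans le_pi).
rewrite big_split_ord /= -big_split; apply: ler_sum => i _ /=.
rewrite !big_split_ord /= -!big_split; apply: ler_sum => j _ /=.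
rewrite /conj_pairs !(row_mxEl, row_mxEr) !mxE /p.
(* Conjugation is an isometry, so the four distances in a block take only two values; the mixed one
   is the larger. *)
have E : normc (conjc (lam i) - conjc (mu j)) = normc (lam i - mu j).
  by rewrite -rmorphB normc_conjc.
have E' : normc (conjc (lam i) - mu j) = normc (lam i - conjc (mu j)).
  by rewrite -normc_conjc rmorphB /= conjcK.
rewrite E E'; set u := normc _ ^+ 2.
have := normc_sub_conjc (lam_ge0 i) (mu_ge0 j); rewrite -/u.
move: (normc _ ^+ 2) => v le_uv.
by rewrite !mulrDr lerD // lerD // ler_wpM2r.
Qed.
End ConjugatePairs.

(** * The complex representation [chi_mx] and its effect on norms *)

Section Complexification.
Variable R : realType.
Local Notation H := (quaternion R).
Local Open Scope sesquilinear_scope.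
Local Notation normc := ComplexField.Normc.normc.
Local Notation fst_mx := (map_mx (@quat_fst R)).
Local Notation snd_mx := (map_mx (@quat_snd R)).
Local Notation conj_mx := (map_mx (@conjc R)).
Local Open Scope complex_scope.

Lemma quat_fst_sum I (r : seq I) (F : I -> H) :
  quat_fst (\sum_(i <- r) F i) = \sum_(i <- r) quat_fst (F i).
Proof. exact: (big_morph (@quat_fst R)). Qed.

Lemma quat_snd_sum I (r : seq I) (F : I -> H) :
  quat_snd (\sum_(i <- r) F i) = \sum_(i <- r) quat_snd (F i).
Proof. exact: (big_morph (@quat_snd R)). Qed.

Lemma quat_fstM (p q : H) :
  quat_fst (p * q) = quat_fst p * quat_fst q - quat_snd p * conjc (quat_snd q).
Proof.
case: p q => [a b c d] [a' b' c' d']; apply/eqP; rewrite eq_complex /=.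
by apply/andP; split; apply/eqP; ring.
Qed.

Lemma quat_sndM (p q : H) :
  quat_snd (p * q) = quat_fst p * quat_snd q + quat_snd p * conjc (quat_fst q).
Proof.
case: p q => [a b c d] [a' b' c' d']; apply/eqP; rewrite eq_complex /=.
by apply/andP; split; apply/eqP; ring.
Qed.

Lemma fst_mxM m n p (A : 'M[H]_(m, n)) (B : 'M_(n, p)) :
  fst_mx (A *m B) = fst_mx A *m fst_mx B - snd_mx A *m conj_mx (snd_mx B).
Proof.
apply/matrixP => i j; rewrite !mxE quat_fst_sum -sumrB.
by apply: eq_bigr => k _; rewrite !mxE quat_fstM.
Qed.

Lemma snd_mxM m n p (A : 'M[H]_(m, n)) (B : 'M_(n, p)) :
  snd_mx (A *m B) = fst_mx A *m snd_mx B + snd_mx A *m conj_mx (fst_mx B).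
Proof.
apply/matrixP => i j; rewrite !mxE quat_snd_sum -big_split.
by apply: eq_bigr => k _; rewrite !mxE quat_sndM.
Qed.

Lemma conj_mxK m n (A : 'M[R[i]]_(m, n)) : conj_mx (conj_mx A) = A.
Proof. by apply/matrixP => i j; rewrite !mxE conjcK. Qed.

Lemma chi_mxM n (A B : 'M[H]_n) : chi_mx (A *m B) = chi_mx A *m chi_mx B.
Proof.
rewrite /chi_mx mulmx_block fst_mxM snd_mxM !raddfD !raddfN /= !map_mxM /=.
rewrite !conj_mxK !mulNmx; congr block_mx; first exact: addrC.
exact: addrC.
Qed.

Lemma chi_mxB n (A B : 'M[H]_n) : chi_mx (A - B) = chi_mx A - chi_mx B.
Proof.
rewrite /chi_mx opp_block_mx add_block_mx -!map_mxN.
congr block_mx; apply/matrixP => i j; rewrite !mxE; apply/eqP;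
  by rewrite eq_complex /= ?opprD ?opprK !eqxx.
Qed.

Lemma chi_mx1 n : chi_mx (1%:M : 'M[H]_n) = 1%:M.
Proof.
rewrite /chi_mx -[1%:M in RHS]/(scalar_mx 1) scalar_mx_block.
by congr block_mx; apply/matrixP => i j; rewrite !mxE; case: (i == j) => /=;
  apply/eqP; rewrite eq_complex /= ?oppr0 !eqxx.
Qed.

Lemma chi_mx_adj n (A : 'M[H]_n) : chi_mx (adjmx A) = (chi_mx A)^t*.
Proof.
rewrite /chi_mx tr_block_mx map_block_mx.
congr block_mx; apply/matrixP => i j; rewrite !mxE; apply/eqP;
  by rewrite eq_complex /= ?opprK !eqxx.
Qed.

Lemma chi_complex_diag n (lam : 'I_n -> R[i]) :
  chi_mx (complex_diag lam) = diag_mx (conj_pairs lam).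
Proof.
rewrite /conj_pairs diag_mx_row /chi_mx.
by congr block_mx; apply/matrixP => i j; rewrite !mxE; case: (i == j);
  case: (lam i) => a b; apply/eqP;
  rewrite ?mulr1n ?mulr0n eq_complex /= ?oppr0 !eqxx.
Qed.

Lemma absq_sqr (q : H) :
  absq q ^+ 2 = normc (quat_fst q) ^+ 2 + normc (quat_snd q) ^+ 2.
Proof. by rewrite !normc_sqr /absq sqr_sqrtr ?addr_ge0 ?sqr_ge0 //= addrA. Qed.

Lemma absq_sqrC (q : H) :
  (absq q ^+ 2)%:C = `|quat_fst q| ^+ 2 + `|quat_snd q| ^+ 2.
Proof. by rewrite absq_sqr rmorphD /= !rmorphXn. Qed.

(** Each complex part of [A] occurs in two blocks of [chi_mx A], up to sign and conjugation, whence
    the factor 2. *)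
Lemma fro2_chi n (A : 'M[H]_n) :
  fro2 (chi_mx A) = 2%:R * (frobenius_norm A ^+ 2)%:C.
Proof.
rewrite /frobenius_norm sqr_sqrtr; last first.
  by do 2![apply: sumr_ge0 => ? _]; rewrite sqr_ge0.
rewrite mulr_natl mulr2n !rmorph_sum -[RHS]big_split /fro2 big_split_ord /=.
rewrite -[LHS]big_split /=; apply: eq_bigr => i _.
rewrite rmorph_sum -[RHS]big_split !big_split_ord /=.
rewrite -[X in X + _]big_split -[X in _ + X]big_split -[LHS]big_split /=.
apply: eq_bigr => j _; rewrite absq_sqrC.
rewrite block_mxEul block_mxEur block_mxEdl block_mxEdr !mxE.
by rewrite normrN !(normcJ (quat_fst _), normcJ (quat_snd _)) [X in _ + X]addrC.
Qed.

(** This is the first block column of the complex representation of [x]. The map is an isometric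
    bijection that turns the action of [A] into that of [chi_mx A], so operator bounds transfer. *)
Definition embed_cV n (x : 'cV[H]_n) : 'cV[R[i]]_(n + n) :=
  col_mx (fst_mx x) (- conj_mx (snd_mx x)).

Lemma embed_cV_mulmx n (A : 'M[H]_n) (x : 'cV_n) :
  embed_cV (A *m x) = chi_mx A *m embed_cV x.
Proof.
rewrite /embed_cV /chi_mx mul_block_col fst_mxM snd_mxM raddfD /= !map_mxM /=.
rewrite conj_mxK !mulmxN !mulNmx opprD; congr col_mx; exact: addrC.
Qed.

Lemma embed_cV_surj n (v : 'cV[R[i]]_(n + n)) : exists x, v = embed_cV x.
Proof.
exists (\col_i Quat (complex.Re (usubmx v i 0)) (complex.Im (usubmx v i 0))
                    (- complex.Re (dsubmx v i 0)) (complex.Im (dsubmx v i 0))).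
rewrite -[LHS]vsubmxK; congr col_mx; apply/colP => i; rewrite !mxE;
  by case: (v _ _) => a b; apply/eqP; rewrite eq_complex /= ?opprK !eqxx.
Qed.

Lemma fro2_embed n (x : 'cV[H]_n) : fro2 (embed_cV x) = (vnorm x ^+ 2)%:C.
Proof.
rewrite /vnorm sqr_sqrtr; last by apply: sumr_ge0 => ? _; rewrite sqr_ge0.
rewrite rmorph_sum /fro2 big_split_ord -[LHS]big_split /=.
apply: eq_bigr => i _; rewrite !big_ord1 absq_sqrC col_mxEu col_mxEd !mxE.
by rewrite normrN (normcJ (quat_snd _)).
Qed.

Lemma absq_eq0 (q : H) : absq q = 0 -> q = 0.
Proof.
case: q => a b c d /(congr1 (fun x => x ^+ 2)).
rewrite expr0n absq_sqr !normc_sqr /= => sum0.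
have := (sqr_ge0 a, sqr_ge0 b, sqr_ge0 c, sqr_ge0 d) => -[[[a2 b2] c2] d2].
by congr Quat; apply/eqP; rewrite -sqrf_eq0 eq_le sqr_ge0 andbT; lra.
Qed.

Lemma vnorm0 n : vnorm (0 : 'cV[H]_n) = 0.
Proof.
rewrite /vnorm big1 ?sqrtr0 // => i _.
by rewrite mxE absq_sqr !normc_sqr /= expr0n !addr0.
Qed.

Lemma vnorm_gt0 n (x : 'cV[H]_n) : x != 0 -> 0 < vnorm x.
Proof.
move=> x0; rewrite lt_def sqrtr_ge0 andbT; apply: contra_neq x0.
move=> /(congr1 (fun r => r ^+ 2)); rewrite expr0n sqr_sqrtr; last first.
  by apply: sumr_ge0 => i _; rewrite sqr_ge0.
move=> /psumr_eq0P x0; apply/colP => i; rewrite mxE; apply: absq_eq0.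
by apply/eqP; rewrite -sqrf_eq0 x0 // => j _; rewrite sqr_ge0.
Qed.

Lemma spectral_norm_bound n (A : 'M[H]_n) (x : 'cV[H]_n) :
  vnorm (A *m x) <= spectral_norm A * vnorm x.
Proof.
have [->|x0] := eqVneq x 0; first by rewrite mulmx0 vnorm0 mulr0.
rewrite -ler_pdivrMr ?vnorm_gt0 // /spectral_norm.
apply: ub_le_sup; last by exists x.
have f2_ge0 : 0 <= 2 * frobenius_norm A ^+ 2 by rewrite pmulr_rge0 ?sqr_ge0.
(* The supremum is an upper bound only if the quotients are bounded; the Frobenius norm of
   [chi_mx A] is a crude bound. *)
exists (Num.sqrt (2 * frobenius_norm A ^+ 2)) => _ [y y0 ->].
rewrite ler_pdivrMr ?vnorm_gt0 // -ler_sqr ?nnegrE ?mulr_ge0 ?sqrtr_ge0 //.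
rewrite exprMn [Num.sqrt (2 * _) ^+ 2]sqr_sqrtr //.
have := fro2_mulmx (chi_mx A) (embed_cV y).
rewrite -embed_cV_mulmx !fro2_embed fro2_chi.
by rewrite -(rmorph_nat (real_complex R)) -!rmorphM lecR.
Qed.

Lemma chi_spectral_bound n (A : 'M[H]_n) (v : 'cV_(n + n)) :
  fro2 (chi_mx A *m v) <= (spectral_norm A ^+ 2)%:C * fro2 v.
Proof.
have [x ->] := embed_cV_surj v; rewrite -embed_cV_mulmx !fro2_embed -rmorphM /=.
rewrite lecR -exprMn ler_sqr ?nnegrE ?sqrtr_ge0 ?spectral_norm_bound //.
(* Comparing squares needs a nonnegative right-hand side, which follows from the bound itself. *)
by rewrite (le_trans _ (spectral_norm_bound A x)) ?sqrtr_ge0.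
Qed.
End Complexification.

(** * Quaternionic adjoints and normality of the companion matrix *)

Section QuaternionAdjoint.
Variable R : realType.
Local Notation H := (quaternion R).

Lemma conjqM (p q : H) : conjq (p * q) = conjq q * conjq p.
Proof. by case: p q => [????] [????]; congr Quat => /=; ring. Qed.

Lemma adj_qmxM m n p (A : 'M[H]_(m, n)) (B : 'M_(n, p)) :
  adjmx (A *m B) = adjmx B *m adjmx A.
Proof.
apply/matrixP => i j; rewrite !mxE (big_morph (@conjq R) (id1 := 0) (op1 := +%R)).
- by apply: eq_bigr => k _; rewrite !mxE conjqM.
- by move=> [????] [????]; congr Quat => /=; ring.
- by congr Quat; rewrite /= ?oppr0.
Qed.

Lemma adj_qmxN m n (A : 'M[H]_(m, n)) : adjmx (- A) = - adjmx A.
Proof. by apply/matrixP => i j; rewrite !mxE; case: (A j i). Qed.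

Lemma adj_qmxK m n (A : 'M[H]_(m, n)) : adjmx (adjmx A) = A.
Proof.
apply/matrixP => i j; rewrite !mxE; case: (A i j) => a b c d.
by rewrite /conjq /= !opprK.
Qed.

Lemma adj_qmx0 m n : adjmx (0 : 'M[H]_(m, n)) = 0.
Proof. by apply/matrixP => i j; rewrite !mxE; congr Quat; rewrite /= oppr0. Qed.

Lemma adj_qmx1 n : adjmx (1%:M : 'M[H]_n) = 1%:M.
Proof.
apply/matrixP => i j; rewrite !mxE eq_sym.
by case: (i == j); congr Quat; rewrite /= oppr0.
Qed.

Lemma adj_qmx_block m1 m2 n1 n2 (A : 'M[H]_(m1, n1)) (B : 'M_(m1, n2))
    (C : 'M_(m2, n1)) (D : 'M_(m2, n2)) :
  adjmx (block_mx A B C D) =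
  block_mx (adjmx A) (adjmx C) (adjmx B) (adjmx D).
Proof.
have adjE m n (M : 'M[H]_(m, n)) : adjmx M = map_mx (@conjq R) (trmx M).
  by apply/matrixP => i j; rewrite !mxE.
by rewrite !adjE tr_block_mx map_block_mx.
Qed.

(** In the two products, the off-diagonal blocks agree by the relation between [B1] and [B0] and by
    its adjoint; the diagonal blocks agree by unitarity of [B0] and normality of [B1]. *)
Lemma companion2_normal n (B0 B1 : 'M[H]_n) :
  unitary_qmx B0 -> normal_qmx B1 -> adjmx B1 *m B0 = - B1 ->
  normal_qmx (companion2 B0 B1).
Proof.
move=> [B0r B0l] nB1 B10.
have B01 : adjmx B0 *m B1 = - adjmx B1.
  by rewrite -{1}(adj_qmxK B1) -adj_qmxM B10 adj_qmxN.
rewrite /normal_qmx /companion2 adj_qmx_block adj_qmx0 adj_qmx1 !adj_qmxN.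
rewrite !mulmx_block.
rewrite !(mul0mx, mulmx0, mul1mx, mulmx1, add0r, addr0, mulNmx, mulmxN, opprK).
by rewrite B0r B0l B10 B01 nB1 addrC.
Qed.
End QuaternionAdjoint.

(** * Transfer of the complex estimate to the standard eigenvalues *)

Theorem theorem3p13 (R : realType) (n : nat)
    (A0 A1 A2 B0 B1 : 'M[quaternion R]_n)
    (A0_unitary : unitary_qmx A0) (A1_unitary : unitary_qmx A1)
    (A2_unitary : unitary_qmx A2)
    (A01_comm : comm_mx A0 A1) (A02_comm : comm_mx A0 A2)
    (A12_comm : comm_mx A1 A2)
    (B0_unitary : unitary_qmx B0) (B1_normal : normal_qmx B1)
    (B1B0 : adjmx B1 *m B0 = - B1) :
  let CP := companion2 (invqmx A2 *m A0) (invqmx A2 *m A1) in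
  let CQ := companion2 B0 B1 in
  forall (lam mu : 'I_(n + n) -> R[i])
    (lam_eig : standard_eigenvalues CP lam)
    (mu_eig : standard_eigenvalues CQ mu)
    (X : 'M[quaternion R]_(n + n))
    (X_nonsing : nonsingular X)
    (X_diag : invqmx X *m CP *m X = complex_diag lam),
  exists pi : {perm 'I_(n + n)},
    \sum_(i < n + n) ComplexField.Normc.normc (lam i - mu (pi i)) ^+ 2
      <= spectral_norm X ^+ 2 * spectral_norm (invqmx X) ^+ 2
         * frobenius_norm (CP - CQ) ^+ 2.
Proof.
move=> CP CQ lam mu [lam_ge0 _] [mu_ge0 mu_char] X /invqmxP[XY _] X_diag.
have nCQ : chi_mx CQ \is normalmx.
  apply/normalmxP; rewrite -chi_mx_adj -!chi_mxM; congr chi_mx.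
  exact: companion2_normal.
(* The spectral theorem lists the eigenvalues in an unspecified order; [t] aligns them with the
   conjugate pairs of [mu]. *)
have [t tE] : exists t : {perm 'I_((n + n) + (n + n))},
    forall i, spectral_diag (chi_mx CQ) 0 (t i) = conj_pairs mu 0 i.
  apply: spectral_diag_perm => //; rewrite mu_char [RHS]big_split_ord /=.
  by congr (_ * _); apply: eq_bigr => i _; rewrite ?row_mxEl ?row_mxEr mxE.
have chiXY : chi_mx X *m chi_mx (invqmx X) = 1%:M by rewrite -chi_mxM XY chi_mx1.
have chi_diag : chi_mx (invqmx X) *m chi_mx CP *m chi_mx X =
    diag_mx (conj_pairs lam) by rewrite -!chi_mxM X_diag chi_complex_diag.
have x2_ge0 : 0 <= ((spectral_norm X ^+ 2)%:C)%C by rewrite ler0c sqr_ge0.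
have [Z uZ] := hoffman_wielandt_diagonalizable x2_ge0 nCQ chiXY chi_diag
  (chi_spectral_bound X) (chi_spectral_bound (invqmx X)).
rewrite -chi_mxB fro2_chi => leZ.
pose q a b := ComplexField.Normc.normc (Z a (t b)) ^+ 2.
have qC a b : ((q a b)%:C = `|Z a (t b)| ^+ 2)%C by rewrite /q rmorphXn.
have [| | |pi le_pi] := @conj_pairs_assignment _ _ lam mu q lam_ge0 mu_ge0.
- by move=> a b; rewrite sqr_ge0.
- move=> a; apply: (@complexI R); rewrite rmorph1 rmorph_sum /=.
  rewrite (eq_bigr _ (fun b _ => qC a b)); transitivity (\sum_b `|Z a b| ^+ 2).
    by rewrite [RHS](reindex_inj (@perm_inj _ t)).
  by rewrite -mulmx_adj_diag (unitarymxP uZ) mxE eqxx.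
- move=> b; apply: (@complexI R); rewrite rmorph1 rmorph_sum /=.
  rewrite (eq_bigr _ (fun a _ => qC a b)) -adj_mulmx_diag.
  by rewrite (mulmx1C (unitarymxP uZ)) mxE eqxx.
(* The 2 from folding the pairs cancels the 2 in the Frobenius norm of [chi_mx (CP - CQ)]. *)
exists pi; rewrite -(ler_pM2l (ltr0n R 2)) (le_trans le_pi) // -lecR.
move: leZ; rewrite -(rmorph_nat (real_complex R)) -!rmorphM /=.
rewrite mulrCA; apply: le_trans; rewrite rmorph_sum le_eqVlt; apply/predU1P; left.
apply: eq_bigr => a _; rewrite rmorph_sum [RHS](reindex_inj (@perm_inj _ t)).
by apply: eq_bigr => b _; rewrite rmorphM rmorphXn /= qC tE.
Qed.
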